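(* Let $\Bbbk$ be a commutative ring and $0\le m\le+\infty$. There are bijections $$\mathrm{Der}^m_{\Bbbk}(A,B)\cong\mathrm{Meas}(A,C_m,B)\cong\mathsf{Coalg}_{\Bbbk}(C_m,P(A,B))$$ natural in the $\Bbbk$-algebras $A$ and $B$.
   Context: Algebras are associative and unital, not necessarily commutative; coalgebras are coassociative and counital. A higher derivation (Hasse–Schmidt derivation) of length $m$ from $A$ to $B$ consists of $\Bbbk$-linear maps $D_k\colon A\to B$, $0\le k\le m$ (all $k\in\mathbb{N}$ if $m=+\infty$), such that $D_0$ is a $\Bbbk$-algebra morphism and $D_k(xy)=\sum_{i+j=k}D_i(x)D_j(y)$ for $x,y\in A$; $\mathrm{Der}^m_{\Bbbk}(A,B)$ is the set of these. $C_m$ is the $\Bbbk$-coalgebra which is free as a $\Bbbk$-module on $\{v_i:0\le i\le m\}$ ($i\in\mathbb{N}$ if $m=+\infty$), with $\Delta(v_k)=\sum_{i+j=k}v_i\otimes v_j$ and $\varepsilon(v_k)=\delta_{0,k}$. For a $\Bbbk$-coalgebra $C$, $\mathrm{Meas}(A,C,B)$ is the set of measurings, i.e. $\Bbbk$-linear maps $\phi\colon A\otimes C\to B$ with $\phi(aa'\otimes c)=\sum\phi(a\otimes c_1)\phi(a'\otimes c_2)$ (Sweedler notation) and $\phi(1\otimes c)=\varepsilon(c)1$. $P(A,B)$ is the universal measuring coalgebra: the $\Bbbk$-coalgebra representing $C\mapsto\mathrm{Meas}(A,C,B)$, i.e. $\mathsf{Coalg}_{\Bbbk}(C,P(A,B))\cong\mathrm{Meas}(A,C,B)$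 naturally (it exists since $\Bbbk$-modules form a locally presentable symmetric monoidal closed category). *)

(* Defs.v *)
From HB Require Import structures.
From mathcomp Require Import all_boot all_order all_algebra finmap generic_quotient.
From mathcomp Require Import boolp classical_sets functions cardinality fsbigop.
Set Implicit Arguments.
Unset Strict Implicit.
Unset Printing Implicit Defensive.
Import GRing.Theory.
Local Open Scope ring_scope.
Local Open Scope quotient_scope.

Section Linear.
Variable k : comPzRingType.

Definition mk_linear (U V : lmodType k) (f : U -> V) (Hf : linear f) : {linear U -> V} :=
  HB.pack f (GRing.isLinear.Build k U V *:%R f Hf).

Lemma linear_eq (U V : lmodType k) (f g : {linear U -> V}) : f =1 g -> f = g.
Proof.
move=> /funext; case: f g => [f [[a] [b]]] [g [[a'] [b']]] /= E.
move: a b a' b'; rewrite E => a b a' b'.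
by rewrite (Prop_irrelevance a a') (Prop_irrelevance b b').
Qed.

Section PlainLinear.
Variables (U V : lmodType k) (f : U -> V).
Hypothesis Hf : linear f.

Lemma lin0 : f 0 = 0. Proof. exact: (linear0 (mk_linear Hf)). Qed.
Lemma linD x y : f (x + y) = f x + f y. Proof. exact: (linearD (mk_linear Hf)). Qed.
Lemma linZ c x : f (c *: x) = c *: f x. Proof. exact: (linearZ_LR (mk_linear Hf)). Qed.
Lemma lin_sum I (r : seq I) (Q : pred I) (F : I -> U) :
  f (\sum_(i <- r | Q i) F i) = \sum_(i <- r | Q i) f (F i).
Proof. exact: (linear_sum (mk_linear Hf)). Qed.

End PlainLinear.

Definition bilin (M N P : lmodType k) (f : M -> N -> P) : Prop :=
  (forall m, linear (f m)) /\ (forall n, linear (f^~ n)).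

End Linear.

(** * Associative unital algebras

    The library's [algType] excludes the zero algebra; this record does not. *)

Record alg (k : comPzRingType) := Alg {
  alg_ring : pzRingType;
  alg_scale : k -> alg_ring -> alg_ring;
  alg_scaleA : forall a b x, alg_scale a (alg_scale b x) = alg_scale (a * b) x;
  alg_scale1 : forall x, alg_scale 1 x = x;
  alg_scaleDr : forall a x y, alg_scale a (x + y) = alg_scale a x + alg_scale a y;
  alg_scaleDl : forall a b x, alg_scale (a + b) x = alg_scale a x + alg_scale b x;
  alg_scaleAl : forall a x y, alg_scale a (x * y) = alg_scale a x * y;
  alg_scaleAr : forall a x y, alg_scale a (x * y) = x * alg_scale a y }.

Definition alg_sort (k : comPzRingType) (A : alg k) : Type := alg_ring A.
HB.instance Definition _ (k : comPzRingType) (A : alg k) :=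
  GRing.PzRing.on (alg_sort A).
HB.instance Definition _ (k : comPzRingType) (A : alg k) :=
  GRing.Zmodule_isLmodule.Build k (alg_sort A) (@alg_scaleA k A) (@alg_scale1 k A)
    (@alg_scaleDr k A) (fun x a b => @alg_scaleDl k A a b x).
Coercion alg_sort : alg >-> Sortclass.
Definition alg_lmod (k : comPzRingType) (A : alg k) : lmodType k := alg_sort A.
Coercion alg_lmod : alg >-> GRing.Lmodule.type.

Definition alg_of_algType (k : comPzRingType) (A : algType k) : alg k :=
  @Alg k A *:%R (@scalerA k A) (@scale1r k A) (@scalerDr k A)
    (fun a b x => @scalerDl k A x a b) (@scalerAl k A) (@scalerAr k A).

Record alg_hom (k : comPzRingType) (A B : alg k) := AlgHom {
  alg_hom_fun :> {linear A -> B};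
  alg_homP : monoid_morphism alg_hom_fun }.

Lemma algAl (k : comPzRingType) (A : alg k) (c : k) (x y : A) :
  c *: (x * y) = (c *: x) * y.
Proof. exact: alg_scaleAl. Qed.

Lemma algAr (k : comPzRingType) (A : alg k) (c : k) (x y : A) :
  c *: (x * y) = x * (c *: y).
Proof. exact: alg_scaleAr. Qed.

Lemma bilin_mul (k : comPzRingType) (M N : lmodType k) (A : alg k)
  (f : M -> A) (g : N -> A) : linear f -> linear g -> bilin (fun m n => f m * g n).
Proof.
move=> Hf Hg; split=> [m c x y|n c x y].
  by rewrite Hg mulrDr -algAr.
by rewrite Hf mulrDl -algAl.
Qed.

(** * Tensor products of modules

    [M ⊗ N] consists of the formal sums of pairs (m, n), modulo the congruence
    generated by commutativity of the sum and bilinearity of the pairing. *)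

Section Tensor.
Variables (k : comPzRingType) (M N : lmodType k).

Inductive tens_rel : seq (M * N) -> seq (M * N) -> Prop :=
| tens_rel_refl s : tens_rel s s
| tens_rel_sym s t : tens_rel s t -> tens_rel t s
| tens_rel_trans s t u : tens_rel s t -> tens_rel t u -> tens_rel s u
| tens_rel_cat s s' t t' : tens_rel s s' -> tens_rel t t' -> tens_rel (s ++ t) (s' ++ t')
| tens_rel_catC s t : tens_rel (s ++ t) (t ++ s)
| tens_rel_0 n : tens_rel [:: (0, n)] [::]
| tens_rel_Dl m m' n : tens_rel [:: (m + m', n)] [:: (m, n); (m', n)]
| tens_rel_Dr m n n' : tens_rel [:: (m, n + n')] [:: (m, n); (m, n')]
| tens_rel_Z c m n : tens_rel [:: (c *: m, n)] [:: (m, c *: n)].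

Let tens_relb : rel (seq (M * N)) := fun s t => `[< tens_rel s t >].

Let tens_relb_refl : reflexive tens_relb.
Proof. by move=> s; apply/asboolP; exact: tens_rel_refl. Qed.

Let tens_relb_sym : symmetric tens_relb.
Proof. by move=> s t; apply/asboolP/asboolP; exact: tens_rel_sym. Qed.

Let tens_relb_trans : transitive tens_relb.
Proof.
by move=> t s u /asboolP st /asboolP tu; apply/asboolP; exact: tens_rel_trans tu.
Qed.

Canonical tens_equiv := EquivRel tens_relb tens_relb_refl tens_relb_sym tens_relb_trans.

Definition tensor : Type := {eq_quot tens_equiv}.
HB.instance Definition _ := Choice.on tensor.

Definition tcls (s : seq (M * N)) : tensor := \pi_({eq_quot tens_equiv}) s.
Definition trepr (t : tensor) : seq (M * N) := repr (t : {eq_quot tens_equiv}).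

Lemma tclsP t : exists s, t = tcls s.
Proof. by exists (trepr t); rewrite /tcls /trepr reprK. Qed.

Lemma tcls_eqP s t : tcls s = tcls t <-> tens_rel s t.
Proof. by split => [/eqmodP/asboolP|st] //; apply/eqmodP/asboolP. Qed.

Lemma trepr_rel s : tens_rel (trepr (tcls s)) s.
Proof. by apply/tcls_eqP; rewrite /tcls /trepr reprK. Qed.

Definition tens (m : M) (n : N) : tensor := tcls [:: (m, n)].
Definition tens_zero : tensor := tcls [::].
Definition tens_add (x y : tensor) : tensor := tcls (trepr x ++ trepr y).
Definition tens_scale (c : k) (x : tensor) : tensor :=
  tcls [seq (c *: p.1, p.2) | p <- trepr x].
Definition tens_opp (x : tensor) : tensor := tens_scale (- 1) x.

Let piD s t : tens_add (tcls s) (tcls t) = tcls (s ++ t).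
Proof. by apply/tcls_eqP; apply: tens_rel_cat; exact: trepr_rel. Qed.

Let scale_rel (c : k) s t : tens_rel s t ->
  tens_rel [seq (c *: p.1, p.2) | p <- s] [seq (c *: p.1, p.2) | p <- t].
Proof.
elim=> {s t} [s|s t _ ?|s t u _ ? _ ?|s s' t t' _ ? _ ?|s t|n|m m' n|m n n'|d m n] /=.
- exact: tens_rel_refl.
- exact: tens_rel_sym.
- exact: (@tens_rel_trans _ [seq (c *: p.1, p.2) | p <- t]).
- by rewrite !map_cat; exact: tens_rel_cat.
- by rewrite !map_cat; exact: tens_rel_catC.
- by rewrite scaler0; exact: tens_rel_0.
- by rewrite scalerDr; exact: tens_rel_Dl.
- exact: tens_rel_Dr.
- by rewrite scalerA mulrC -scalerA; exact: tens_rel_Z.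
Qed.

Let piZ c s : tens_scale c (tcls s) = tcls [seq (c *: p.1, p.2) | p <- s].
Proof. by apply/tcls_eqP; apply: scale_rel; exact: trepr_rel. Qed.

Let tens_addA : associative tens_add.
Proof.
move=> x y z; case: (tclsP x) (tclsP y) (tclsP z) => s -> [t ->] [u ->].
by rewrite !piD catA.
Qed.

Let tens_addC : commutative tens_add.
Proof. by move=> x y; apply/tcls_eqP; exact: tens_rel_catC. Qed.

Let tens_add0 : left_id tens_zero tens_add.
Proof. by move=> x; case: (tclsP x) => s ->; rewrite piD. Qed.

Let tens_scaleDl x c d : tens_scale (c + d) x = tens_add (tens_scale c x) (tens_scale d x).
Proof.
case: (tclsP x) => {x} s ->; rewrite !piZ piD; elim: s => [|p s /tcls_eqP IH] //=.
rewrite -(cat1s (c *: p.1, p.2)) -piD -(cat1s (d *: p.1, p.2)) catA.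
rewrite -cat1s -piD.
have -> : tcls [:: ((c + d) *: p.1, p.2)] =
    tens_add (tcls [:: (c *: p.1, p.2)]) (tcls [:: (d *: p.1, p.2)]).
  by rewrite piD scalerDl; apply/tcls_eqP; exact: tens_rel_Dl.
move/tcls_eqP: IH => ->; rewrite -!piD.
by rewrite -!tens_addA; congr tens_add; rewrite !tens_addA; congr tens_add; rewrite tens_addC.
Qed.

Let tens_scale0 x : tens_scale 0 x = tens_zero.
Proof.
case: (tclsP x) => {x} s ->; rewrite piZ; elim: s => [|p s IH] //=.
rewrite -cat1s -piD IH tens_addC tens_add0 scale0r.
by apply/tcls_eqP; exact: tens_rel_0.
Qed.

Let tens_scale1 : left_id 1 tens_scale.
Proof.
move=> x; case: (tclsP x) => s ->; rewrite piZ; congr tcls.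
by rewrite -[RHS]map_id; apply: eq_map => -[m n] /=; rewrite scale1r.
Qed.

Let tens_addN : left_inverse tens_zero tens_opp tens_add.
Proof.
move=> x; rewrite -[X in tens_add _ X]tens_scale1 /tens_opp -tens_scaleDl.
by rewrite addNr tens_scale0.
Qed.

HB.instance Definition _ :=
  GRing.isZmodule.Build tensor tens_addA tens_addC tens_add0 tens_addN.

Let tens_scaleA c d x : tens_scale c (tens_scale d x) = tens_scale (c * d) x.
Proof.
case: (tclsP x) => s ->; rewrite !piZ -map_comp; congr tcls.
by apply: eq_map => -[m n] /=; rewrite scalerA.
Qed.

Let tens_scaleDr : right_distributive tens_scale +%R.
Proof.
move=> c x y; case: (tclsP x) (tclsP y) => s -> [t ->].
change (tens_scale c (tens_add (tcls s) (tcls t)) =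
  tens_add (tens_scale c (tcls s)) (tens_scale c (tcls t))).
by rewrite piD !piZ piD map_cat.
Qed.

HB.instance Definition _ := GRing.Zmodule_isLmodule.Build k tensor
  tens_scaleA tens_scale1 tens_scaleDr tens_scaleDl.

Lemma tens_bilin : bilin (tens : M -> N -> tensor).
Proof.
split=> [m c n n'|n c m m'].
  rewrite -[RHS]/(tens_add (tens_scale c (tcls _)) (tcls _)) piZ piD.
  apply/tcls_eqP; apply: tens_rel_trans (tens_rel_Dr _ _ _) _ => /=.
  rewrite -cat1s -[[:: _; _] in X in _ X]cat1s; apply: tens_rel_cat.
    by apply: tens_rel_sym; exact: tens_rel_Z.
  exact: tens_rel_refl.
rewrite -[RHS]/(tens_add (tens_scale c (tcls _)) (tcls _)) piZ piD.
by apply/tcls_eqP; exact: tens_rel_Dl.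
Qed.

Lemma tens_ind (Q : tensor -> Prop) :
  Q 0 -> (forall m n t, Q t -> Q (tens m n + t)) -> forall t, Q t.
Proof.
move=> Q0 QD t; case: (tclsP t) => s ->; elim: s => [|[m n] s /(QD m n)] //.
by rewrite -[tens m n + _]/(tens_add (tcls _) (tcls _)) piD.
Qed.

(** The value is meaningful for bilinear [f] only. *)
Definition tlift (P : lmodType k) (f : M -> N -> P) (t : tensor) : P :=
  \sum_(p <- trepr t) f p.1 p.2.

Section Lift.
Variables (P : lmodType k) (f : M -> N -> P).
Hypothesis Hf : bilin f.

Let sum_rel s t : tens_rel s t ->
  \sum_(p <- s) f p.1 p.2 = \sum_(p <- t) f p.1 p.2.
Proof.
elim=> {s t} [s|s t _ ?|s t u _ -> _ ->|s s' t t' _ h _ h'|s t|n|m m' n|m n n'|d m n] //=.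
- by rewrite !big_cat /= h h'.
- by rewrite !big_cat /= addrC.
- by rewrite big_seq1 big_nil; exact: (lin0 (Hf.2 n)).
- by rewrite !big_cons !big_nil /= !addr0; exact: (linD (Hf.2 n)).
- by rewrite !big_cons !big_nil /= !addr0; exact: (linD (Hf.1 m)).
- by rewrite !big_seq1 /= (linZ (Hf.2 n)) (linZ (Hf.1 m)).
Qed.

Let tlift_pi s : tlift f (tcls s) = \sum_(p <- s) f p.1 p.2.
Proof. by apply: sum_rel; exact: trepr_rel. Qed.

Lemma tliftE m n : tlift f (tens m n) = f m n.
Proof. by rewrite tlift_pi big_seq1. Qed.

Lemma tlift_linear : linear (tlift f).
Proof.
move=> c x y; case: (tclsP x) (tclsP y) => s -> [t ->].
rewrite -[c *: _ + _]/(tens_add (tens_scale c (tcls _)) (tcls _)) piZ piD.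
rewrite !tlift_pi big_cat /= big_map scaler_sumr; congr (_ + _).
by apply: eq_bigr => -[m n] _ /=; rewrite (linZ (Hf.2 n)).
Qed.

End Lift.

Lemma tens_ext (P : lmodType k) (f g : tensor -> P) : linear f -> linear g ->
  (forall m n, f (tens m n) = g (tens m n)) -> f =1 g.
Proof.
move=> Hf Hg fg; elim/tens_ind=> [|m n t IH].
  by rewrite (lin0 Hf) (lin0 Hg).
by rewrite (linD Hf) (linD Hg) fg IH.
Qed.

Lemma tlift_unique (P : lmodType k) (f : M -> N -> P) (g : tensor -> P) :
  bilin f -> linear g -> (forall m n, g (tens m n) = f m n) -> g =1 tlift f.
Proof.
move=> Hf Hg gf; apply: tens_ext => // [|m n]; first exact: tlift_linear.
by rewrite gf tliftE.
Qed.

Lemma tlift_comp (P Q : lmodType k) (f : M -> N -> P) (g : {linear P -> Q}) t :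
  g (tlift f t) = tlift (fun m n => g (f m n)) t.
Proof. by rewrite /tlift linear_sum. Qed.

End Tensor.

Notation "M ⊗ N" := (tensor M N) (at level 40, left associativity) : type_scope.

Section TensorMaps.
Variable k : comPzRingType.
Implicit Types M N L : lmodType k.

Lemma tlift_lin M N L (P : lmodType k) (f : M -> N -> P) (g : L -> M ⊗ N) :
  bilin f -> linear g -> linear (fun x => tlift f (g x)).
Proof. by move=> Hf Hg c x y; rewrite Hg (tlift_linear Hf). Qed.

Definition tmap M M' N N' (f : M -> M') (g : N -> N') : M ⊗ N -> M' ⊗ N' :=
  tlift (fun m n => tens (f m) (g n)).

Definition tassoc M N L : (M ⊗ N) ⊗ L -> M ⊗ (N ⊗ L) :=
  tlift (fun x l => tlift (fun m n => tens m (tens n l)) x).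

Lemma bilin_tens M M' N N' (f : M -> M') (g : N -> N') :
  linear f -> linear g -> bilin (fun m n => tens (f m) (g n)).
Proof.
move=> Hf Hg; split=> [m c x y|n c x y].
  by rewrite Hg (tens_bilin _ _).1.
by rewrite Hf (tens_bilin _ _).2.
Qed.

Lemma tmapE M M' N N' (f : M -> M') (g : N -> N') m n :
  linear f -> linear g -> tmap f g (tens m n) = tens (f m) (g n).
Proof. by move=> Hf Hg; rewrite /tmap tliftE //; exact: bilin_tens. Qed.

Lemma tmap_linear M M' N N' (f : M -> M') (g : N -> N') :
  linear f -> linear g -> linear (tmap f g).
Proof. by move=> Hf Hg; apply: tlift_linear; exact: bilin_tens. Qed.

Let bilin_assoc2 M N L (l : L) : bilin (fun (m : M) (n : N) => tens m (tens n l)).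
Proof.
by split=> [m c x y|n c x y]; rewrite ?(tens_bilin _ _).2 ?(tens_bilin _ _).1 ?(tens_bilin _ _).2.
Qed.

Let bilin_assoc M N L :
  bilin (fun x (l : L) => tlift (fun (m : M) (n : N) => tens m (tens n l)) x).
Proof.
split=> [x c l l'|l]; last by apply: tlift_linear; exact: bilin_assoc2.
elim/tens_ind: x => [|m n t IH].
  have h l0 : tlift (fun (m : M) (n : N) => tens m (tens n l0)) 0 = 0.
    apply: lin0; apply: tlift_linear; exact: bilin_assoc2.
  by rewrite !h scaler0 addr0.
have h l0 := linD (tlift_linear (@bilin_assoc2 M N L l0)).
rewrite !h IH !tliftE; try exact: bilin_assoc2.
by rewrite !(tens_bilin _ _).1 scalerDr !addrA; congr (_ + _); rewrite addrAC.
Qed.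

Lemma tassocE M N L (m : M) (n : N) (l : L) :
  tassoc (tens (tens m n) l) = tens m (tens n l).
Proof. by rewrite /tassoc !tliftE. Qed.

Lemma tassoc_linear M N L : linear (@tassoc M N L).
Proof. by apply: tlift_linear; exact: bilin_assoc. Qed.

End TensorMaps.
Section Free.
Local Open Scope classical_set_scope.
Variables (k : comPzRingType) (I : choiceType).

Definition fin_supp : pred (I -> k^o) := fun f => `[< finite_set [set i | f i != 0] >].

Lemma fin_suppP (f : I -> k^o) :
  reflect (exists A : {fset I}, forall i, i \notin A -> f i = 0) (fin_supp f).
Proof.
apply: (iffP (asboolP _)) => [/finite_fsetP[A fA]|[A fA]].
  exists A => i iA; apply/eqP; apply: contraNT iA => fi0.
  by have : [set i | f i != 0] i by []; rewrite fA.
by apply: (finite_subfset A) => i /=; apply: contra_neqT => /fA.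
Qed.

Lemma fin_supp_submod : GRing.subsemimod_closed fin_supp.
Proof.
split; first split.
- by apply/fin_suppP; exists fset0.
- move=> f g /fin_suppP[A fA] /fin_suppP[B gB]; apply/fin_suppP.
  exists (A `|` B)%fset => i; rewrite inE negb_or => /andP[iA iB].
  by rewrite -[LHS]/(f i + g i) fA // gB // addr0.
- move=> c f /fin_suppP[A fA]; apply/fin_suppP; exists A => i iA.
  by rewrite -[LHS]/(c *: f i) fA // scaler0.
Qed.

Definition freemod := {f : I -> k^o | fin_supp f}.
HB.instance Definition _ := SubChoice.on freemod.
HB.instance Definition _ := GRing.isSubmodClosed.Build k (I -> k^o) fin_supp fin_supp_submod.
HB.instance Definition _ := [SubChoice_isSubLmodule of freemod by <:].

Lemma fbasis_supp (i : I) : fin_supp (fun j => (j == i)%:R).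
Proof.
by apply/fin_suppP; exists [fset i]%fset => j; rewrite inE => /negPf ->.
Qed.

Definition fbasis (i : I) : freemod := Sub (fun j => (j == i)%:R) (fbasis_supp i).

(** The linear map extending [g] from the basis. *)
Definition fext (M : lmodType k) (g : I -> M) (f : freemod) : M :=
  \sum_(i \in [set: I]) (val f i : k) *: g i.

Lemma fextE_fset (M : lmodType k) (g : I -> M) (f : freemod) (A : {fset I}) :
  (forall i, i \notin A -> val f i = 0) -> fext g f = \sum_(i <- A) (val f i : k) *: g i.
Proof. by move=> fA; apply: fsbigTE => i /fA ->; rewrite scale0r. Qed.

Lemma fext_linear (M : lmodType k) (g : I -> M) : linear (fext g).
Proof.
move=> c f h; have /fin_suppP[A fA] := valP f; have /fin_suppP[B hB] := valP h.
have fAB i : i \notin (A `|` B)%fset -> val f i = 0.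
  by rewrite inE negb_or => /andP[/fA].
have hAB i : i \notin (A `|` B)%fset -> val h i = 0.
  by rewrite inE negb_or => /andP[_ /hB].
have fhAB i : i \notin (A `|` B)%fset -> val (c *: f + h) i = 0.
  move=> iAB; rewrite -[LHS]/(c * val f i + val h i) fAB // hAB //.
  by rewrite mulr0 addr0.
rewrite (fextE_fset _ fAB) (fextE_fset _ hAB) (fextE_fset _ fhAB).
rewrite scaler_sumr -big_split /=; apply: eq_bigr => i _.
by rewrite scalerA -scalerDl.
Qed.

Lemma fextE (M : lmodType k) (g : I -> M) i : fext g (fbasis i) = g i.
Proof.
rewrite (@fextE_fset _ _ _ [fset i]%fset) => [|j]; last by rewrite inE => /negPf /= ->.
by rewrite big_seq_fset1 /= eqxx scale1r.
Qed.

Lemma fbasis_span (f : freemod) : f = fext fbasis f.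
Proof.
have /fin_suppP[A fA] := valP f; rewrite (fextE_fset _ fA).
apply: val_inj; apply/funext => j.
have lin_val : linear (fun g : freemod => val g j : k^o) by [].
rewrite (lin_sum lin_val).
under eq_bigr do rewrite (linZ lin_val) /=.
have [jA|/[dup] jA /fA fj] := boolP (j \in A).
  rewrite (big_fsetD1 j) //= eqxx -[_ *: _]/(_ * _) mulr1 big1_seq ?addr0 // => i.
  by rewrite !inE /= => /andP[ij _]; rewrite [j == i]eq_sym (negPf ij) scaler0.
rewrite fj big1_seq // => i /= iA; case: eqVneq iA jA => [-> -> //|_ _ _].
by rewrite scaler0.
Qed.

Lemma fext_unique (M : lmodType k) (f h : freemod -> M) : linear f -> linear h ->
  (forall i, f (fbasis i) = h (fbasis i)) -> f =1 h.
Proof.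
move=> Hf Hh fh u; rewrite [u]fbasis_span; have /fin_suppP[A uA] := valP u.
rewrite (fextE_fset _ uA) (lin_sum Hf) (lin_sum Hh); apply: eq_bigr => i _.
by rewrite (linZ Hf) (linZ Hh) fh.
Qed.

End Free.
(** * Coalgebras

    The counit laws are stated through the isomorphisms k ⊗ C = C = C ⊗ k. *)

Record coalg (k : comPzRingType) := Coalg {
  coalg_lmod :> lmodType k;
  comul : {linear coalg_lmod -> coalg_lmod ⊗ coalg_lmod};
  counit : {linear coalg_lmod -> k^o};
  coassoc : forall c, tassoc (tmap comul id (comul c)) = tmap id comul (comul c);
  counitl : forall c, tlift (fun x y => (counit x : k) *: y) (comul c) = c;
  counitr : forall c, tlift (fun x y => (counit y : k) *: x) (comul c) = c }.

Record coalg_hom (k : comPzRingType) (C D : coalg k) := CoalgHom {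
  coalg_hom_fun :> {linear C -> D};
  coalg_hom_comul : forall c,
    comul D (coalg_hom_fun c) = tmap coalg_hom_fun coalg_hom_fun (comul C c);
  coalg_hom_counit : forall c, counit D (coalg_hom_fun c) = counit C c }.

Section CoalgCat.
Variable k : comPzRingType.

Lemma coalg_hom_eq (C D : coalg k) (f g : coalg_hom C D) : f =1 g -> f = g.
Proof.
case: f g => [f f1 f2] [g g1 g2] /= /linear_eq fg.
move: f1 f2; rewrite fg => f1 f2; congr CoalgHom; exact: Prop_irrelevance.
Qed.

Lemma tmap_comp (M N P M' N' P' : lmodType k) (f : M -> N) (g : N -> P)
  (f' : M' -> N') (g' : N' -> P') : linear f -> linear g -> linear f' -> linear g' ->
  tmap (g \o f) (g' \o f') =1 tmap g g' \o tmap f f'.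
Proof.
move=> Hf Hg Hf' Hg'.
have Hgf : linear (g \o f) by move=> c x y /=; rewrite Hf Hg.
have Hgf' : linear (g' \o f') by move=> c x y /=; rewrite Hf' Hg'.
apply: tens_ext => [||m n].
- exact: tmap_linear.
- by move=> c x y /=; rewrite !tmap_linear.
- by rewrite /= !tmapE.
Qed.

Lemma linear_id (M : lmodType k) : linear (id : M -> M).
Proof. by []. Qed.

Lemma tmap_id (M N : lmodType k) : tmap (@id M) (@id N) =1 id.
Proof.
apply: tens_ext => // [|m n]; first exact: tmap_linear.
by rewrite tmapE.
Qed.

Lemma coalg_id_comul (C : coalg k) c : comul C c = tmap id id (comul C c).
Proof. by rewrite tmap_id. Qed.

Definition coalg_id (C : coalg k) : coalg_hom C C :=
  @CoalgHom k C C (mk_linear (@linear_id C)) (@coalg_id_comul C) (fun=> erefl).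

Section Comp.
Variables (C D E : coalg k) (g : coalg_hom D E) (f : coalg_hom C D).

Lemma coalg_comp_linear : linear (g \o f).
Proof. by move=> c x y /=; rewrite !linearP. Qed.

Lemma coalg_comp_comul c : comul E ((g \o f) c) = tmap (g \o f) (g \o f) (comul C c).
Proof. by rewrite tmap_comp; try exact: linearP; rewrite /= !coalg_hom_comul. Qed.

Lemma coalg_comp_counit c : counit E ((g \o f) c) = counit C c.
Proof. by rewrite /= !coalg_hom_counit. Qed.

Definition coalg_comp : coalg_hom C E :=
  @CoalgHom k C E (mk_linear coalg_comp_linear) coalg_comp_comul coalg_comp_counit.
End Comp.

End CoalgCat.

(** * The coalgebras C_m

    A length [m] in N ∪ {+oo} is an [option nat], with [None] for +oo. *)

Definition leq_len (m : option nat) : pred nat :=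
  fun i => if m is Some n then (i <= n)%N else true.

Definition idx (m : option nat) := {i : nat | leq_len m i}.

Section Idx.
Variable m : option nat.

Lemma idx_le (n : idx m) (i : nat) :
  (i <= val n)%N -> leq_len m i.
Proof. by case: n => n /=; rewrite /leq_len; case: m => // p np /leq_trans; apply. Qed.

Lemma idx0_proof : leq_len m 0.
Proof. by case: m. Qed.

Definition idx0 : idx m := Sub 0%N idx0_proof.

(** The pairs [(idxl i, idxr i)], for [i < n.+1], are those with sum [n]. *)
Definition idxl (n : idx m) (i : 'I_(val n).+1) : idx m := Sub (val i) (idx_le (leq_ord i)).
Definition idxr (n : idx m) (i : 'I_(val n).+1) : idx m :=
  Sub (val n - val i)%N (idx_le (leq_subr (val i) (val n))).

End Idx.

Section Cm.
Variables (k : comPzRingType) (m : option nat).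

Let v (n : idx m) : freemod k (idx m) := fbasis k n.

Definition Cm_comul : {linear freemod k (idx m) -> freemod k (idx m) ⊗ freemod k (idx m)} :=
  mk_linear (fext_linear (fun n => \sum_(i < (val n).+1) tens (v (idxl i)) (v (idxr i)))).

Definition Cm_counit : {linear freemod k (idx m) -> k^o} :=
  mk_linear (fext_linear (fun n => (val n == 0%N)%:R : k^o)).

Let Cm_comulE n : Cm_comul (v n) = \sum_(i < (val n).+1) tens (v (idxl i)) (v (idxr i)).
Proof. exact: fextE. Qed.

Let Cm_counitE n : Cm_counit (v n) = (val n == 0%N)%:R.
Proof. exact: fextE. Qed.

Let w (n : nat) : freemod k (idx m) := if insub n is Some i then v i else 0.

Let wE (n : idx m) : w (val n) = v n.
Proof. by rewrite /w valK. Qed.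

Let w_comul (n : idx m) (j : nat) : (j <= val n)%N ->
  Cm_comul (w j) = \sum_(i < j.+1) tens (w i) (w (j - i)).
Proof.
move=> jn; rewrite -[j]/(val (Sub j (idx_le jn) : idx m)) wE Cm_comulE /=.
by apply: eq_bigr => i _; rewrite -!wE.
Qed.

Let w_counit (n : idx m) (j : nat) : (j <= val n)%N -> Cm_counit (w j) = (j == 0%N)%:R.
Proof.
by move=> jn; rewrite -[j]/(val (Sub j (idx_le jn) : idx m)) wE Cm_counitE.
Qed.

Let triangle (V : nmodType) (n : nat) (F : nat -> nat -> nat -> V) :
  \sum_(i < n.+1) \sum_(a < i.+1) F a (i - a)%N (n - i)%N =
  \sum_(a < n.+1) \sum_(b < (n - a).+1) F a b (n - a - b)%N.
Proof.
transitivity (\sum_(i < n.+1) \sum_(a < n.+1 | (a < i.+1)%N) F a (i - a)%N (n - i)%N).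
  apply: eq_bigr => i _.
  by rewrite (big_ord_widen n.+1 (fun a => F a (i - a)%N (n - i)%N) (ltn_ord i)).
rewrite (exchange_big_dep xpredT) //=; apply: eq_bigr => a _.
have an : (a <= n)%N := leq_ord a.
rewrite (eq_bigl (fun i : 'I_n.+1 => (a <= i)%N)) //.
rewrite -(big_geq_mkord a n.+1 xpredT (fun i => F a (i - a)%N (n - i)%N)).
rewrite -{1}[val a]add0n big_addn subSn // big_mkord; apply: eq_bigr => b _.
by rewrite addnK addnC subnDA.
Qed.

Lemma Cm_coassoc c : tassoc (tmap Cm_comul id (Cm_comul c)) = tmap id Cm_comul (Cm_comul c).
Proof.
have lD : linear Cm_comul by exact: linearP.
have ltl : linear (tmap Cm_comul (@id (freemod k (idx m)))) by exact: tmap_linear.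
have ltr : linear (tmap (@id (freemod k (idx m))) Cm_comul) by exact: tmap_linear.
have la := @tassoc_linear k (freemod k (idx m)) (freemod k (idx m)) (freemod k (idx m)).
apply: (fext_unique (f := fun c => tassoc (tmap Cm_comul id (Cm_comul c)))
  (h := fun c => tmap id Cm_comul (Cm_comul c))) => [a x y|a x y|n].
- by rewrite lD ltl la.
- by rewrite lD ltr.
rewrite -[fbasis k n]/(v n) -wE (w_comul (leqnn _)) (lin_sum ltl) (lin_sum la) (lin_sum ltr).
transitivity (\sum_(i < (val n).+1) \sum_(a < i.+1)
    tens (w a) (tens (w (i - a)%N) (w (val n - i)%N))).
  apply: eq_bigr => i _; rewrite tmapE // (w_comul (leq_ord i)).
  rewrite (lin_sum ((tens_bilin _ _).2 _)) (lin_sum la).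
  by apply: eq_bigr => a _; rewrite tassocE.
rewrite (triangle _ (fun a b c => tens (w a) (tens (w b) (w c)))).
apply: eq_bigr => a _; rewrite tmapE // (w_comul (leq_subr _ _)).
by rewrite (lin_sum ((tens_bilin _ _).1 _)).
Qed.

Let bilin_eps1 : bilin (fun x y : freemod k (idx m) => (Cm_counit x : k) *: y).
Proof.
split=> [x a y y'|y a x x']; first by rewrite scalerDr !scalerA mulrC.
by rewrite linearP scalerDl scalerA.
Qed.

Let bilin_eps2 : bilin (fun x y : freemod k (idx m) => (Cm_counit y : k) *: x).
Proof.
split=> [x a y y'|y a x x']; last by rewrite scalerDr !scalerA mulrC.
by rewrite linearP scalerDl scalerA.
Qed.

Lemma Cm_counitl c : tlift (fun x y => (Cm_counit x : k) *: y) (Cm_comul c) = c.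
Proof.
have lt := tlift_linear bilin_eps1.
apply: (fext_unique (f := fun c => tlift (fun x y => (Cm_counit x : k) *: y) (Cm_comul c))
  (h := id)) => // [a x y|n]; first by rewrite linearP lt.
rewrite -[fbasis k n]/(v n) -wE (w_comul (leqnn _)) (lin_sum lt) big_ord_recl tliftE //.
rewrite -[nat_of_ord ord0]/0%N (w_counit (leq0n (val n))) scale1r subn0 big1 ?addr0 // => i _.
by rewrite tliftE // (w_counit (n := n)) ?scale0r // lift0.
Qed.

Lemma Cm_counitr c : tlift (fun x y => (Cm_counit y : k) *: x) (Cm_comul c) = c.
Proof.
have lt := tlift_linear bilin_eps2.
apply: (fext_unique (f := fun c => tlift (fun x y => (Cm_counit y : k) *: x) (Cm_comul c))
  (h := id)) => // [a x y|n]; first by rewrite linearP lt.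
rewrite -[fbasis k n]/(v n) -wE (w_comul (leqnn _)) (lin_sum lt) big_ord_recr tliftE //.
rewrite -[nat_of_ord ord_max]/(val n) subnn (w_counit (leq0n (val n))) scale1r.
rewrite big1 => [|i _]; first exact: add0r.
rewrite tliftE // (w_counit (leq_subr _ _)) subn_eq0 leqNgt -[nat_of_ord (widen_ord _ _)]/(nat_of_ord i) ltn_ord.
exact: scale0r.
Qed.

Definition Cm : coalg k := Coalg Cm_coassoc Cm_counitl Cm_counitr.

End Cm.

Record hder (k : comPzRingType) (m : option nat) (A B : alg k) := HDer {
  hder_fun :> idx m -> {linear A -> B};
  hder0 : monoid_morphism (hder_fun (idx0 m));
  hderM : forall (n : idx m) (x y : A),
    hder_fun n (x * y) =
      \sum_(i < (val n).+1) hder_fun (idxl i) x * hder_fun (idxr i) y }.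

Section HDer.
Variables (k : comPzRingType) (m : option nat).

Lemma hder_eq (A B : alg k) (D E : hder m A B) : (forall n, D n =1 E n) -> D = E.
Proof.
case: D E => [D D0 DM] [E E0 EM] /= DE.
have {DE} DE : D = E by apply/funext => n; apply: linear_eq.
move: D0 DM; rewrite DE => D0 DM; congr HDer; exact: Prop_irrelevance.
Qed.

Section Map.
Variables (A A' B B' : alg k) (f : alg_hom A' A) (g : alg_hom B B') (D : hder m A B).

Lemma hder_map_linear n : linear (fun x => g (D n (f x))).
Proof. by move=> c x y; rewrite !linearP. Qed.

Definition hder_map_fun n : {linear A' -> B'} := mk_linear (hder_map_linear n).

Lemma hder_map0 : monoid_morphism (hder_map_fun (idx0 m)).
Proof.
split => [|x y] /=; first by rewrite (alg_homP f).1 (hder0 D).1 (alg_homP g).1.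
by rewrite (alg_homP f).2 (hder0 D).2 (alg_homP g).2.
Qed.

Lemma hder_mapM n x y : hder_map_fun n (x * y) =
  \sum_(i < (val n).+1) hder_map_fun (idxl i) x * hder_map_fun (idxr i) y.
Proof.
rewrite /= (alg_homP f).2 hderM linear_sum; apply: eq_bigr => i _.
exact: (alg_homP g).2.
Qed.

Definition hder_map : hder m A' B' := HDer hder_map0 hder_mapM.
End Map.

End HDer.

Record meas (k : comPzRingType) (A : alg k) (C : coalg k) (B : alg k) := Meas {
  meas_fun :> {linear A ⊗ C -> B};
  meas_mul : forall (a a' : A) (c : C),
    meas_fun (tens (a * a') c) =
      tlift (fun c1 c2 => meas_fun (tens a c1) * meas_fun (tens a' c2)) (comul C c);
  meas_one : forall c : C, meas_fun (tens (1 : A) c) = (counit C c : k) *: (1 : B) }.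

Section Meas.
Variable k : comPzRingType.

Lemma meas_eq (A B : alg k) (C : coalg k) (phi psi : meas A C B) :
  (forall a c, phi (tens a c) = psi (tens a c)) -> phi = psi.
Proof.
case: phi psi => [f f1 f2] [g g1 g2] /= fg.
have {}fg : f = g.
  by apply: linear_eq; apply: tens_ext => //; exact: linearP.
move: f1 f2; rewrite fg => f1 f2; congr Meas; exact: Prop_irrelevance.
Qed.

Lemma bilin_meas (A B : alg k) (C : coalg k) (phi : meas A C B) (a a' : A) :
  bilin (fun c1 c2 => phi (tens a c1) * phi (tens a' c2)).
Proof.
by apply: bilin_mul => c x y; rewrite (tens_bilin _ _).1 linearP.
Qed.

Section Map.
Variables (A A' B B' : alg k) (C C' : coalg k).
Variables (f : alg_hom A' A) (h : coalg_hom C' C) (g : alg_hom B B').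
Variable phi : meas A C B.

Definition meas_map_fun (t : A' ⊗ C') : B' := g (phi (tmap f h t)).

Lemma meas_map_linear : linear meas_map_fun.
Proof.
move=> c x y; rewrite /meas_map_fun tmap_linear; try exact: linearP.
by rewrite !linearP.
Qed.

Lemma meas_map_tens a c : meas_map_fun (tens a c) = g (phi (tens (f a) (h c))).
Proof. by rewrite /meas_map_fun tmapE //; exact: linearP. Qed.

Lemma meas_map_mul (a a' : A') (c : C') :
  mk_linear meas_map_linear (tens (a * a') c) =
  tlift (fun c1 c2 => mk_linear meas_map_linear (tens a c1) *
                      mk_linear meas_map_linear (tens a' c2)) (comul C' c).
Proof.
rewrite /= meas_map_tens (alg_homP f).2 meas_mul coalg_hom_comul tlift_comp.
have lh : linear h by exact: linearP.
have H2 : bilin (fun c1 c2 => g (phi (tens (f a) c1) * phi (tens (f a') c2))).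
  have [H1 H2] := bilin_meas phi (f a) (f a').
  by split=> [x|x] d y z; rewrite ?H1 ?H2 linearP.
have H3 : bilin (fun c1 c2 => meas_map_fun (tens a c1) * meas_map_fun (tens a' c2)).
  by apply: bilin_mul => d x y; rewrite (tens_bilin _ _).1 meas_map_linear.
pose F t := tlift (fun c1 c2 => g (phi (tens (f a) c1) * phi (tens (f a') c2)))
  (tmap h h t).
rewrite -[LHS]/(F (comul C' c)).
apply: (tlift_unique (g := F)) => // [|c1 c2].
  by move=> d x y; rewrite /F tmap_linear // tlift_linear.
by rewrite /F tmapE // tliftE // !meas_map_tens (alg_homP g).2.
Qed.

Lemma meas_map_one (c : C') : mk_linear meas_map_linear (tens (1 : A') c) = (counit C' c : k) *: (1 : B').
Proof.
rewrite /= meas_map_tens (alg_homP f).1 meas_one linearZ_LR (alg_homP g).1.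
by rewrite coalg_hom_counit.
Qed.

Definition meas_map : meas A' C' B' := Meas meas_map_mul meas_map_one.
End Map.

Lemma alg_id_proof (A : alg k) : monoid_morphism (mk_linear (@linear_id k A)).
Proof. by []. Qed.

Definition alg_id (A : alg k) : alg_hom A A := AlgHom (alg_id_proof A).

End Meas.

(** A universal measuring coalgebra P(A, B) is an object representing the functor
    [C |-> Meas(A, C, B)], given with the natural bijection [um_meas]. *)

Record univ_meas (k : comPzRingType) (A B : alg k) := UnivMeas {
  um_coalg :> coalg k;
  um_meas : forall C : coalg k, coalg_hom C um_coalg -> meas A C B;
  um_hom : forall C : coalg k, meas A C B -> coalg_hom C um_coalg;
  um_measK : forall C : coalg k, cancel (@um_meas C) (@um_hom C);
  um_homK : forall C : coalg k, cancel (@um_hom C) (@um_meas C);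
  um_natural : forall (C C' : coalg k) (h : coalg_hom C' C) (f : coalg_hom C um_coalg),
    um_meas (coalg_comp f h) = meas_map (alg_id A) h (alg_id B) (um_meas f) }.

(** [P(f, g) : P(A, B) -> P(A', B')], the morphism induced through the Yoneda lemma by
    the natural transformation [Meas(f, -, g)]. *)
Definition um_map (k : comPzRingType) (A A' B B' : alg k)
    (P : univ_meas A B) (P' : univ_meas A' B')
    (f : alg_hom A' A) (g : alg_hom B B') : coalg_hom P P' :=
  um_hom P' (meas_map f (coalg_id P) g (um_meas (coalg_id P))).

(* Main.v *)
Require Import Defs.
From HB Require Import structures.
From mathcomp Require Import all_boot all_order all_algebra.
Set Implicit Arguments.
Unset Strict Implicit.
Unset Printing Implicit Defensive.
Import GRing.Theory.
Local Open Scope ring_scope.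

(** The coalgebra C_m is free on the v_n, so a linear map A ⊗ C_m -> B is the
    same thing as a family of linear maps D_n : A -> B, with D_n a the value at
    a ⊗ v_n. Both conditions defining a measuring are linear in the argument
    from C_m, hence may be tested on the v_n alone. Substituting
    Δ(v_n) = Σ v_i ⊗ v_(n-i) in the multiplicativity condition gives exactly
    the Leibniz rule of a higher derivation, and ε(v_n) = δ_(0,n) turns the unit
    condition into D_0 1 = 1 together with D_n 1 = 0 for n > 0. A higher
    derivation is only asked for D_0 1 = 1, but the Leibniz rule applied to
    1 * 1 forces the remaining equations ([hder_one]). This is the bijection
    [meas_of_hder] / [hder_of_meas]; composing with algebra morphisms on either
    side does not affect the C_m variable, whence naturality.

    The second bijection is the universal property of P(A, B) evaluated at C_m.
    Its naturality in A and B is the Yoneda lemma: every measuring phi is the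
    pullback of the universal one A ⊗ P(A, B) -> B along [um_hom P phi]
    ([um_measE]), and P(f, g) is defined by the image of the universal
    measuring under Meas(f, -, g). *)

Section CmBasis.
Variables (k : comPzRingType) (m : option nat).

Lemma comul_Cm_basis (n : idx m) :
  comul (Cm k m) (fbasis k n) =
    \sum_(i < (val n).+1) tens (fbasis k (idxl i)) (fbasis k (idxr i)).
Proof. exact: fextE. Qed.

Lemma counit_Cm_basis (n : idx m) :
  counit (Cm k m) (fbasis k n) = (val n == 0%N)%:R.
Proof. exact: fextE. Qed.

Lemma tlift_comul_Cm (M : lmodType k)
    (f : freemod k (idx m) -> freemod k (idx m) -> M) (n : idx m) : bilin f ->
  tlift f (comul (Cm k m) (fbasis k n)) =
    \sum_(i < (val n).+1) f (fbasis k (idxl i)) (fbasis k (idxr i)).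
Proof.
move=> Hf; rewrite comul_Cm_basis (lin_sum (tlift_linear Hf)).
by apply: eq_bigr => i _; rewrite tliftE.
Qed.

End CmBasis.

Section HderMeas.
Variables (k : comPzRingType) (m : option nat) (A B : alg k).

(** If D_j 1 = 0 for 0 < j < n, the Leibniz rule for 1 * 1 reads
    D_n 1 = D_n 1 + D_n 1, and so D_n 1 = 0. *)
Lemma hder_one (D : hder m A B) (n : idx m) : D n 1 = (val n == 0%N)%:R.
Proof.
have [p] := ubnP (val n); elim: p n => // p IH n np.
have [n0|n_gt0] := posnP (val n).
  by rewrite (_ : n = idx0 m) ?(hder0 D).1 //; apply: val_inj.
apply: (addrI (D n 1)); rewrite addr0 -[in RHS](mulr1 (1 : A)) hderM.
(* By induction only the end terms i = 0 and i = n survive; for n > 0 they are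
   distinct, and D_0 1 = 1 makes each of them equal to D_n 1. *)
have -> : \sum_(i < (val n).+1) D (idxl i) 1 * D (idxr i) 1 =
    \sum_(i < (val n).+1) ((i == 0%N :> nat)%:R * D n 1 + D n 1 * (i == val n :> nat)%:R).
  apply: eq_bigr => i _; have := leq_ord i; rewrite leq_eqVlt => /predU1P[ni|ltin].
    have -> : idxr i = idx0 m.
      by apply: val_inj; exact: etrans (congr1 (subn (val n)) ni) (subnn _).
    have -> : idxl i = n by apply: val_inj.
    by rewrite (hder0 D).1 ni eqxx gtn_eqF // mul0r add0r.
  rewrite (ltn_eqF ltin) mulr0 addr0 (IH (idxl i)) ?(leq_trans ltin) //=.
  have [i0|//] := eqVneq (i : nat) 0%N; last by rewrite !mul0r.
  by congr (_ * D _ _); apply: val_inj; exact: etrans (congr1 (subn (val n)) i0) (subn0 _).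
rewrite big_split /= -mulr_suml -mulr_sumr.
rewrite (bigD1 ord0) //= big1 ?addr0 ?mul1r => [|i]; last first.
  by rewrite -val_eqE /= => /negPf ->.
rewrite (bigD1 ord_max) //= eqxx big1 ?addr0 ?mulr1 // => i.
by rewrite -val_eqE /= => /negPf ->.
Qed.

Section OfHder.
Variable D : hder m A B.

Lemma bilin_hder : bilin (fun a => fext (fun n => D n a)).
Proof.
split=> [a|c d x y]; first exact: fext_linear.
pose F z := fext (fun n => D n z).
have lF z : linear (F z) by exact: fext_linear.
apply: (fext_unique (f := F (d *: x + y))
  (h := fun u => d *: F x u + F y u)) => // [e u v|n].
  by rewrite !lF !scalerDr !scalerA mulrC !addrA; congr (_ + _); rewrite addrAC.
by rewrite /F !fextE linearP.
Qed.

Definition meas_of_hder_fun : {linear A ⊗ Cm k m -> B} :=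
  mk_linear (tlift_linear bilin_hder).

Lemma meas_of_hder_funE a u :
  meas_of_hder_fun (tens a u) = fext (fun n => D n a) u.
Proof. exact: tliftE bilin_hder _ _. Qed.

(** At u = v_n this is the Leibniz rule, and both sides are linear in u. *)
Lemma meas_of_hder_mul (a a' : A) (u : Cm k m) :
  meas_of_hder_fun (tens (a * a') u) =
    tlift (fun u1 u2 => meas_of_hder_fun (tens a u1) * meas_of_hder_fun (tens a' u2))
      (comul (Cm k m) u).
Proof.
have ltens b : linear (fun w => meas_of_hder_fun (tens b w)).
  by move=> d x y; rewrite (tens_bilin _ _).1 linearP.
have Hb := bilin_mul (ltens a) (ltens a').
apply: (fext_unique (f := fun u => meas_of_hder_fun (tens (a * a') u))
  (h := fun u => tlift _ (comul (Cm k m) u))) => [|d x y|n]; first exact: ltens.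
  by rewrite linearP (tlift_linear Hb).
rewrite (tlift_comul_Cm n Hb) meas_of_hder_funE fextE hderM.
by apply: eq_bigr => i _; rewrite !meas_of_hder_funE !fextE.
Qed.

(** At u = v_n this is [hder_one]. *)
Lemma meas_of_hder_one (u : Cm k m) :
  meas_of_hder_fun (tens (1 : A) u) = (counit (Cm k m) u : k) *: (1 : B).
Proof.
apply: (fext_unique (f := fun u => meas_of_hder_fun (tens (1 : A) u))
  (h := fun u => (counit (Cm k m) u : k) *: (1 : B))) => [d x y|d x y|n].
- by rewrite (tens_bilin _ _).1 linearP.
- by rewrite linearP scalerDl scalerA.
rewrite meas_of_hder_funE fextE hder_one counit_Cm_basis.
by rewrite scaler_nat.
Qed.

Definition meas_of_hder : meas A (Cm k m) B := Meas meas_of_hder_mul meas_of_hder_one.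

Lemma meas_of_hder_basis a n : meas_of_hder (tens a (fbasis k n)) = D n a.
Proof. by rewrite meas_of_hder_funE fextE. Qed.

End OfHder.

Section OfMeas.
Variable phi : meas A (Cm k m) B.

Lemma hder_of_meas_linear (n : idx m) : linear (fun a => phi (tens a (fbasis k n))).
Proof. by move=> c x y; rewrite (tens_bilin _ _).2 linearP. Qed.

Definition hder_of_meas_fun n : {linear A -> B} := mk_linear (hder_of_meas_linear n).

Lemma hder_of_measM (n : idx m) (x y : A) :
  hder_of_meas_fun n (x * y) =
    \sum_(i < (val n).+1) hder_of_meas_fun (idxl i) x * hder_of_meas_fun (idxr i) y.
Proof.
rewrite /= meas_mul; exact: tlift_comul_Cm (bilin_meas phi x y).
Qed.

Lemma hder_of_meas0 : monoid_morphism (hder_of_meas_fun (idx0 m)).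
Proof.
split=> [|x y]; first by rewrite /= meas_one counit_Cm_basis scale1r.
rewrite hder_of_measM big_ord_recl big_ord0 addr0.
by congr (hder_of_meas_fun _ _ * hder_of_meas_fun _ _); apply: val_inj.
Qed.

Definition hder_of_meas : hder m A B := HDer hder_of_meas0 hder_of_measM.

End OfMeas.

(** Linear maps out of the free module C_m are determined on the v_n. *)
Lemma meas_Cm_eq (phi psi : meas A (Cm k m) B) :
  (forall a n, phi (tens a (fbasis k n)) = psi (tens a (fbasis k n))) -> phi = psi.
Proof.
move=> E; apply: meas_eq => a.
have l (chi : meas A (Cm k m) B) : linear (fun u => chi (tens a u)).
  by move=> d x y; rewrite (tens_bilin _ _).1 linearP.
exact: fext_unique (l phi) (l psi) (E a).
Qed.

Lemma meas_of_hderK : cancel meas_of_hder hder_of_meas.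
Proof. by move=> D; apply: hder_eq => n a; exact: meas_of_hder_basis. Qed.

Lemma hder_of_measK : cancel hder_of_meas meas_of_hder.
Proof. by move=> phi; apply: meas_Cm_eq => a n; rewrite meas_of_hder_basis. Qed.

End HderMeas.

Lemma meas_map_tensE (k : comPzRingType) (A A' B B' : alg k) (C C' : coalg k)
    (f : alg_hom A' A) (h : coalg_hom C' C) (g : alg_hom B B') (phi : meas A C B) a c :
  meas_map f h g phi (tens a c) = g (phi (tens (f a) (h c))).
Proof. exact: meas_map_tens. Qed.

Lemma meas_of_hder_natural (k : comPzRingType) (m : option nat) (A A' B B' : alg k)
    (f : alg_hom A' A) (g : alg_hom B B') (D : hder m A B) :
  meas_of_hder (hder_map f g D) = meas_map f (coalg_id (Cm k m)) g (meas_of_hder D).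
Proof.
by apply: meas_Cm_eq => a n; rewrite meas_map_tensE !meas_of_hder_basis.
Qed.

Section Universal.
Variables (k : comPzRingType) (C : coalg k).

(** The Yoneda lemma: naturality of [um_meas], applied to h = id ∘ h, exhibits
    every measuring as the pullback of the universal one, the image of id. *)
Lemma um_measE (A B : alg k) (P : univ_meas A B) (h : coalg_hom C P) a c :
  um_meas h (tens a c) = um_meas (coalg_id P) (tens a (h c)).
Proof.
have -> : h = coalg_comp (coalg_id P) h by exact: coalg_hom_eq.
by rewrite um_natural meas_map_tensE.
Qed.

(** Both sides pull the universal measuring of A' and B' back to
    a ⊗ c |-> g (phi (f a ⊗ c)), and [um_meas] is injective. *)
Lemma um_hom_natural (A A' B B' : alg k) (P : univ_meas A B) (P' : univ_meas A' B')
    (f : alg_hom A' A) (g : alg_hom B B') (phi : meas A C B) :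
  um_hom P' (meas_map f (coalg_id C) g phi) =
    coalg_comp (um_map P P' f g) (um_hom P phi).
Proof.
apply: (can_inj (@um_measK k A' B' P' C)); rewrite um_homK um_natural um_homK.
apply: meas_eq => a c; rewrite !meas_map_tensE /=.
by rewrite -{1}[phi](um_homK P) um_measE.
Qed.

End Universal.

Theorem lemma8p1 (k : comPzRingType) (m : option nat) :
  (exists alpha : forall A B : alg k, hder m A B -> meas A (Cm k m) B,
     (forall A B : alg k, bijective (alpha A B)) /\
     (forall (A A' B B' : alg k) (f : alg_hom A' A) (g : alg_hom B B') (D : hder m A B),
        alpha A' B' (hder_map f g D) =
          meas_map f (coalg_id (Cm k m)) g (alpha A B D)))
  /\
  (forall P : forall A B : alg k, univ_meas A B,
   exists beta : forall A B : alg k,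
       meas A (Cm k m) B -> coalg_hom (Cm k m) (P A B),
     (forall A B : alg k, bijective (beta A B)) /\
     (forall (A A' B B' : alg k) (f : alg_hom A' A) (g : alg_hom B B')
             (phi : meas A (Cm k m) B),
        beta A' B' (meas_map f (coalg_id (Cm k m)) g phi) =
          coalg_comp (um_map (P A B) (P A' B') f g) (beta A B phi))).
Proof.
split; [exists (@meas_of_hder k m) |
  move=> P; exists (fun A B => @um_hom k A B (P A B) (Cm k m))].
  split=> [A B|]; last exact: meas_of_hder_natural.
  by exists (@hder_of_meas k m A B); [exact: meas_of_hderK | exact: hder_of_measK].
split=> [A B|A A' B B' f g phi]; last exact: um_hom_natural.
by exists (@um_meas k A B (P A B) (Cm k m)); [exact: um_homK | exact: um_measK].
Qed.
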